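(* Let $p$ be an odd prime and $r$ a positive integer. Then \[ \sum_{\substack{i+j+k=p^{r}\\ i,j,k\in \mathcal{P}_{p}}}\frac{(-1)^{i}}{ijk}\equiv \frac{1}{2}p^{r-1}B_{p-3} \pmod{p^{r}}. \]
   Context: $\mathcal{P}_{n}$ denotes the set of positive integers coprime to $n$; the sum runs over ordered triples of positive integers $(i,j,k)$, each coprime to $p$, with $i+j+k=p^r$. The Bernoulli numbers $B_k$ are defined by $B_0=1$ and $\sum_{i=0}^{n}\binom{n+1}{i}B_{i}=0$ for $n\geq 1$. Congruences between rational numbers whose denominators are coprime to $p$ are understood in the ring of $p$-integral rationals: $a\equiv b \pmod{p^s}$ means $(a-b)/p^s$ has denominator coprime to $p$. *)

(* Defs.v *)
From HB Require Import structures.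
From mathcomp Require Import all_boot all_order all_algebra.

Set Implicit Arguments.
Unset Strict Implicit.
Unset Printing Implicit Defensive.

Import Order.TTheory GRing.Theory Num.Theory.
Local Open Scope ring_scope.

Definition posCoprime (n : nat) : pred nat :=
  fun m => (0 < m)%N && coprime m n.

(* bernoulli_seq n = [:: B_0; ...; B_(n-1)], where the recurrence
   \sum_(i < n.+1) 'C(n.+1, i) * B_i = 0 (n >= 1) is solved for B_n, whose
   coefficient is n.+1; see bernoulli0 and bernoulli_rec. *)
Fixpoint bernoulli_seq (n : nat) : seq rat :=
  if n is m.+1 then
    let s := bernoulli_seq m in
    rcons s (if m == 0%N then 1
             else - (\sum_(i < m) 'C(m.+1, i)%:R * s`_i) / m.+1%:R)
  else [::].

Definition bernoulli (n : nat) : rat := (bernoulli_seq n.+1)`_n.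

Lemma size_bernoulli_seq n : size (bernoulli_seq n) = n.
Proof. by elim: n => //= n IHn; rewrite size_rcons IHn. Qed.

Lemma nth_bernoulli_seq n i :
  (i < n)%N -> (bernoulli_seq n)`_i = bernoulli i.
Proof.
elim: n => // n IHn; rewrite ltnS leq_eqVlt => /orP[/eqP-> // | lt_in].
by rewrite /= nth_rcons size_bernoulli_seq lt_in IHn.
Qed.

Lemma bernoulli0 : bernoulli 0 = 1.
Proof. by []. Qed.

Lemma bernoulli_rec n : (0 < n)%N ->
  \sum_(i < n.+1) 'C(n.+1, i)%:R * bernoulli i = 0.
Proof.
move=> n_gt0; rewrite big_ord_recr /= binSn.
rewrite {2}/bernoulli /= nth_rcons size_bernoulli_seq ltnn eqxx.
rewrite -[n == 0]negbK -lt0n n_gt0 /= mulrC divfK ?pnatr_eq0 //.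
under [X in _ - X]eq_bigr => i _ do rewrite nth_bernoulli_seq //.
by rewrite subrr.
Qed.

(* a = b mod p^s in the ring of p-integral rationals.  denq is the (positive)
   denominator in lowest terms. *)
Definition pint_eqmod (p s : nat) (a b : rat) : Prop :=
  coprime `|denq ((a - b) / (p ^ s)%N%:R)|%N p.

(* Main.v *)
Require Import Defs.
From HB Require Import structures.
From mathcomp Require Import all_boot all_order all_algebra.
From mathcomp Require Import ring lra zify.

Set Implicit Arguments.
Unset Strict Implicit.
Unset Printing Implicit Defensive.

Import Order.TTheory GRing.Theory Num.Theory.
Local Open Scope ring_scope.

(** Put q = p^r.  In the local ring Z/q, the involution (i, j, k) |-> (-i, -j, -k)
    exchanges the triples of representatives of sum q with those of sum 2q and
    fixes the summand, so twice the sum runs over all unit pairs (i, j) with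
    i + j a unit.  Partial fractions in j and the vanishing of the sum of all 1/j
    leave, for each i, only the sum of 1/j over the residue class of -i modulo p,
    which is -p^(r-1)/i because inversion permutes residue classes.  It remains
    to see that sum_{0<c<p} (-1)^c/c^3 = -B_{p-3}/2 modulo p.

    There 1/c^3 is c^(p-4).  Put S_n = sum_{c<p} c^n and let O_n be its part with
    c odd.  The binomial recurrences give S_n = p B_n modulo p^2, and the even
    numbers below 2p are the c + p [c odd] with c < p, so that
    2^n S_n = S_n + n p O_(n-1) modulo p^2.  Hence (2^n - 1) B_n = n O_(n-1)
    modulo p, which is applied to n = p - 3. *)

Lemma sum_signr (R : pzRingType) (n : nat) :
  \sum_(i < n) (-1) ^+ i = (odd n)%:R :> R.
Proof.
elim: n => [|n IHn]; first by rewrite big_ord0.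
by rewrite big_ord_recr IHn -signr_odd /=; case: odd; rewrite ?subrr ?add0r.
Qed.

Lemma mulrn_exprV (R : comUnitRingType) (x y : R) (m n : nat) :
    x \is a GRing.unit -> y \is a GRing.unit ->
  x *+ m = y *+ m -> x ^- n *+ m = y ^- n *+ m.
Proof.
move=> x_unit y_unit xy; rewrite -!exprVn.
have inv_xy : x^-1 *+ m = y^-1 *+ m.
  apply: (mulrI x_unit); apply: (mulrI y_unit).
  by rewrite !mulrnAr divrr // mulr1 mulrCA divrr // mulr1.
elim: n => // n IHn.
by rewrite !exprS -mulrnAr IHn mulrnAr -mulrnAl inv_xy mulrnAl.
Qed.

Lemma big_nat_mul_offset (R : Type) (idx : R) (op : Monoid.law idx) (m n : nat)
    (F : nat -> R) :
  \big[op/idx]_(0 <= i < m * n) F i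
  = \big[op/idx]_(0 <= i < m) \big[op/idx]_(0 <= j < n) F (i * n + j)%N.
Proof.
rewrite big_nat_mul; apply: eq_bigr => i _.
rewrite -{1}(add0n (i * n)%N) big_addn mulSn addnK.
by apply: eq_bigr => j _; rewrite addnC.
Qed.

Lemma unitr_neq0 (R : unitRingType) (x : R) : x \is a GRing.unit -> x != 0.
Proof. by apply: contraTneq => ->; rewrite unitr0. Qed.

Section FiniteLocalRing.
Variable R : finComUnitRingType.

Definition num_nonunits : nat := #|[pred x : R | x \isn't a GRing.unit]|.

Hypothesis unitrD_or : forall x y : R,
  x + y \is a GRing.unit -> (x \is a GRing.unit) || (y \is a GRing.unit).
Hypothesis two_unit : (2 : R) \is a GRing.unit.

Lemma sum_odd_eq0 (P : pred R) (f : R -> R) :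
    (forall x, P (- x) = P x) -> (forall x, P x -> f (- x) = - f x) ->
  \sum_(x | P x) f x = 0.
Proof.
move=> P_opp f_opp; apply: (mulrI two_unit); rewrite mulr0 mulr_natl mulr2n.
rewrite {1}(reindex_inj oppr_inj) /= (eq_bigl _ _ P_opp) (eq_bigr _ f_opp).
by rewrite sumrN addNr.
Qed.

Lemma unitr_nonunitB (x a : R) :
  x - a \isn't a GRing.unit -> a \is a GRing.unit -> x \is a GRing.unit.
Proof.
move=> xa_nonunit a_unit; have := @unitrD_or x (a - x).
by rewrite addrC subrK -opprB unitrN (negPf xa_nonunit) orbF; apply.
Qed.

Lemma unitrB_inv (a : R) : a \is a GRing.unit ->
  forall x, (x^-1 - a \isn't a GRing.unit) = (x - a^-1 \isn't a GRing.unit).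
Proof.
suff invB_nonunit (y b : R) : b \is a GRing.unit ->
    y^-1 - b \isn't a GRing.unit -> y - b^-1 \isn't a GRing.unit.
  move=> a_unit x; apply/idP/idP => [|xa_nonunit]; first exact: invB_nonunit.
  by have := invB_nonunit x^-1 a^-1; rewrite !invrK unitrV; apply.
move=> b_unit yb_nonunit.
have y_unit : y \is a GRing.unit by rewrite -unitrV; apply: unitr_nonunitB b_unit.
apply: contra yb_nonunit => yb_unit.
suff -> : y^-1 - b = - (y^-1 * b * (y - b^-1)).
  by rewrite unitrN !unitrM unitrV y_unit b_unit.
by rewrite mulrBr mulrK // mulrAC mulVr // mul1r opprB.
Qed.

(* Inversion maps the residue class of [a] onto the one of [a^-1]. *)
Lemma sum_inv_nonunitB (a : R) : a \is a GRing.unit ->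
  \sum_(x | x - a \isn't a GRing.unit) x^-1 = a^-1 *+ num_nonunits.
Proof.
move=> a_unit; rewrite (reindex_inj invr_inj) /=.
rewrite (eq_bigl _ _ (unitrB_inv a_unit)); under eq_bigr do rewrite invrK.
rewrite (reindex_inj (addrI a^-1)) /=.
rewrite (eq_bigl (fun x => x \isn't a GRing.unit)) => [|x]; last first.
  by rewrite addrC addKr.
rewrite big_split /= sumr_const [X in _ + X]sum_odd_eq0 ?addr0 //.
by move=> x; rewrite unitrN.
Qed.

Lemma sum_inv_unit_pair (i : R) : i \is a GRing.unit ->
  \sum_(j | (j \is a GRing.unit) && (i + j \is a GRing.unit)) j^-1
  = i^-1 *+ num_nonunits.
Proof.
move=> i_unit.
have /eqP : \sum_(j : R | j \is a GRing.unit) j^-1 = 0.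
  by apply: sum_odd_eq0 => [x|x _]; rewrite ?unitrN ?invrN.
rewrite (bigID (fun j => i + j \is a GRing.unit)) /= addr_eq0 => /eqP ->.
rewrite (eq_bigl (fun j => j - - i \isn't a GRing.unit)) => [|j]; last first.
  rewrite opprK addrC; apply: andb_idl; rewrite -[i in j + i]opprK => ij_nonunit.
  by apply: unitr_nonunitB ij_nonunit _; rewrite unitrN.
by rewrite sum_inv_nonunitB ?unitrN // invrN mulNrn opprK.
Qed.

(* Partial fractions: 1/(j(i+j)) = (1/j - 1/(i+j))/i, and j |-> -(i+j)
   exchanges the two terms up to sign. *)
Lemma sum_inv_unit_pairM (i : R) : i \is a GRing.unit ->
  \sum_(j | (j \is a GRing.unit) && (i + j \is a GRing.unit))
     (i * j * (i + j))^-1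
  = i^-1 ^+ 3 *+ num_nonunits *+ 2.
Proof.
move=> i_unit.
transitivity (i^-1 ^+ 2 *
  \sum_(j | (j \is a GRing.unit) && (i + j \is a GRing.unit))
     (j^-1 - (i + j)^-1)).
  rewrite mulr_sumr; apply: eq_bigr => j /andP[j_unit ij_unit].
  have -> : j^-1 - (i + j)^-1 = j^-1 * (i + j)^-1 * i.
    rewrite -[X in _ = _ * X](addrK j i) mulrBr mulrVK //.
    by rewrite mulrAC mulVr // mul1r.
  rewrite !invrM ?unitrM ?i_unit // [RHS]mulrCA expr2 mulrVK //.
  by ring.
rewrite sumrB sum_inv_unit_pair // [X in _ - X](_ : _ = - (i^-1 *+ num_nonunits)).
  by rewrite opprK -mulr2n !mulrnAr -exprSr.
rewrite -(sum_inv_unit_pair i_unit) -sumrN.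
rewrite [RHS](reindex_inj (inj_comp oppr_inj (addrI i))) /=.
apply: eq_big => [j|j _]; last by rewrite invrN opprK.
by rewrite unitrN opprD addNKr unitrN andbC.
Qed.

(* The involution (i, j) |-> (-i, -j) fixes the summand and exchanges [P] with
   its complement, so that the left-hand side is half of the sum over all
   pairs. *)
Lemma sum_half_unit_pairs (s : R -> R) (P : rel R) :
    (forall i, i \is a GRing.unit -> s (- i) = - s i) ->
    (forall i j, i \is a GRing.unit -> j \is a GRing.unit ->
       i + j \is a GRing.unit -> P (- i) (- j) = ~~ P i j) ->
  \sum_(i | i \is a GRing.unit)
     \sum_(j | [&& j \is a GRing.unit, i + j \is a GRing.unit & P i j])
        s i / (i * j * (i + j))
  = (\sum_(i | i \is a GRing.unit) s i / i ^+ 3) *+ num_nonunits.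
Proof.
move=> s_opp P_opp; apply: (mulrI two_unit).
pose half (Q : rel R) := \sum_(i | i \is a GRing.unit)
  \sum_(j | ((j \is a GRing.unit) && (i + j \is a GRing.unit)) && Q i j)
     s i / (i * j * (i + j)).
rewrite [X in 2 * X](_ : _ = half P); last first.
  by apply: eq_bigr => i _; apply: eq_bigl => j; rewrite andbA.
have half_opp : half P = half (fun i j => ~~ P i j).
  rewrite /half (reindex_inj oppr_inj) /=.
  apply: eq_big => [i|i]; rewrite unitrN // => i_unit.
  rewrite (reindex_inj oppr_inj) /=; apply: eq_big => [j|j _]; last first.
    by rewrite s_opp // -opprD mulrNN mulrN invrN mulrNN.
  rewrite -opprD !unitrN; apply: andb_id2l => /andP[j_unit ij_unit].
  exact: P_opp.
rewrite mulr_natl mulr2n {2}half_opp -big_split mulr_natl -!sumrMnl.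
apply: eq_bigr => i i_unit; rewrite -[LHS]bigID -mulr_sumr sum_inv_unit_pairM //=.
by rewrite -exprVn !mulrnAr.
Qed.

End FiniteLocalRing.

Lemma ratr_frac (R : comUnitRingType) (n d : int) :
  (d%:~R : R) \is a GRing.unit -> ratr (n%:~R / d%:~R) = n%:~R / d%:~R :> R.
Proof.
case: divqP => [|k x _]; first by rewrite unitr0.
rewrite !intrM unitrM => /andP[k_unit d_unit].
by rewrite ![k%:~R * _]mulrC invrM // mulrA mulrK.
Qed.

Lemma ratrN (R : comUnitRingType) (x : rat) : ratr (- x) = - ratr x :> R.
Proof. by rewrite /ratr numqN denqN rmorphN mulNr. Qed.

Section RatrUnitDenominators.
Variables (R : comUnitRingType) (D : zmodClosed rat).
Hypothesis denq_unit : forall x, x \in D -> ((denq x)%:~R : R) \is a GRing.unit.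

Lemma ratrD : {in D &, {morph (ratr : rat -> R) : x y / x + y}}.
Proof.
move=> x y /denq_unit x_unit /denq_unit y_unit.
have -> : x + y = (numq x * denq y + numq y * denq x)%:~R / (denq x * denq y)%:~R.
  rewrite rmorphD !rmorphM /= -{1}(divq_num_den x) -{1}(divq_num_den y).
  by field; rewrite !intr_eq0 !denq_neq0.
rewrite ratr_frac ?intrM ?unitrM ?x_unit // rmorphD !rmorphM /= /ratr.
by rewrite mulrDl {2}[(denq x)%:~R * _]mulrC !invrM // !mulrA !mulrK.
Qed.

Lemma ratrMn (x : rat) (n : nat) : x \in D -> ratr (x *+ n) = ratr x *+ n :> R.
Proof.
move=> x_D; elim: n => [|n IHn]; first by rewrite !mulr0n /ratr mul0r.
by rewrite !mulrS ratrD ?rpredMn // IHn.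
Qed.

Lemma ratr_sum (I : Type) (r : seq I) (P : pred I) (F : I -> rat) :
    (forall i, P i -> F i \in D) ->
  ratr (\sum_(i <- r | P i) F i) = \sum_(i <- r | P i) ratr (F i) :> R.
Proof.
move=> F_D; suff [] : \sum_(i <- r | P i) F i \in D /\
  ratr (\sum_(i <- r | P i) F i) = \sum_(i <- r | P i) ratr (F i) :> R by [].
elim/big_rec2: _ => [|i y x Pi [x_D <-]]; first by rewrite rpred0 /ratr mul0r.
by rewrite rpredD ?ratrD ?F_D.
Qed.

End RatrUnitDenominators.

Definition pintegral (p : nat) : {pred rat} :=
  fun x => coprime `|denq x|%N p.

Lemma pintegralP (p : nat) (x : rat) :
  reflect (exists2 d : nat, coprime d p & exists n : int, x * d%:R = n%:~R)
          (x \in pintegral p).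
Proof.
apply: (iffP idP) => [x_p | [d d_p [n xdE]]].
  exists `|denq x|%N => //; exists (numq x).
  by rewrite numqE -[denq x in RHS]absz_denq.
rewrite -topredE /= /pintegral; apply: coprime_dvdl d_p.
have num_den : numq x * d = n * denq x.
  by apply: (@intr_inj rat); rewrite !intrM -xdE numqE; ring.
rewrite -(@Gauss_dvdr _ `|numq x|%N); last first.
  by rewrite coprime_sym coprime_num_den.
by have /(congr1 absz) := num_den; rewrite !abszM /= => ->; apply: dvdn_mull.
Qed.

Lemma pintegral_subring (p : nat) : subring_closed (pintegral p).
Proof.
split=> [|x y|x y].
- by apply/pintegralP; exists 1%N; [rewrite coprime1n | exists 1; rewrite mulr1].
- move=> /pintegralP[d d_p [n xdE]] /pintegralP[e e_p [m yeE]].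
  apply/pintegralP; exists (d * e)%N; first by rewrite coprimeMl d_p.
  exists (n * e%:Z - m * d%:Z).
  by rewrite natrM rmorphB !rmorphM /= -xdE -yeE /=; ring.
- move=> /pintegralP[d d_p [n xdE]] /pintegralP[e e_p [m yeE]].
  apply/pintegralP; exists (d * e)%N; first by rewrite coprimeMl d_p.
  by exists (n * m); rewrite natrM rmorphM /= -xdE -yeE; ring.
Qed.

HB.instance Definition _ (p : nat) :=
  GRing.isSubringClosed.Build rat (pintegral p) (pintegral_subring p).

Lemma pintegralV (p n : nat) : coprime n p -> n%:R^-1 \in pintegral p.
Proof.
move=> n_p; apply/pintegralP; exists n => //.
have [->|n_neq0] := eqVneq n 0%N; first by exists 0; rewrite mulr0.
by exists 1; rewrite mulVf ?pnatr_eq0.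
Qed.

Lemma sign_frac_pintegral (p n d : nat) :
  coprime d p -> (-1) ^+ n / d%:R \in pintegral p.
Proof. by move=> d_p; rewrite rpredM ?rpredX ?rpredN ?rpred1 // pintegralV. Qed.

Section PIntegralCongruence.
Variable p : nat.
Hypothesis p_gt0 : (0 < p)%N.

Lemma pint_eqmodP (s : nat) (a b : rat) :
  pint_eqmod p s a b <-> exists2 w, w \in pintegral p & a = b + p%:R ^+ s * w.
Proof.
rewrite /pint_eqmod natrX -/(pintegral p _).
have ps_neq0 : p%:R ^+ s != 0 :> rat by rewrite expf_neq0 // pnatr_eq0 -lt0n.
split=> [ab | [w w_p ->]]; last by rewrite addrC addKr mulrC mulKf.
by exists ((a - b) / p%:R ^+ s); rewrite // mulrC divfK // addrC subrK.
Qed.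

Lemma pint_eqmod_trans (s : nat) (b a c : rat) :
  pint_eqmod p s a b -> pint_eqmod p s b c -> pint_eqmod p s a c.
Proof.
move=> /pint_eqmodP[v v_p ->] /pint_eqmodP[w w_p ->].
by apply/pint_eqmodP; exists (w + v); rewrite ?rpredD // mulrDr addrA.
Qed.

Lemma pint_eqmod_sum (s : nat) (I : Type) (r : seq I) (P : pred I)
    (F G : I -> rat) :
    (forall i, P i -> pint_eqmod p s (F i) (G i)) ->
  pint_eqmod p s (\sum_(i <- r | P i) F i) (\sum_(i <- r | P i) G i).
Proof.
move=> F_ratr; elim/big_rec2: _ => [|i b a Pi].
  by apply/pint_eqmodP; exists 0; rewrite ?rpred0 ?mulr0 ?addr0.
move=> /pint_eqmodP[w w_p ->].
have /pint_eqmodP[v v_p ->] := F_ratr i Pi.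
by apply/pint_eqmodP; exists (v + w); rewrite ?rpredD // mulrDr addrACA.
Qed.

Lemma pint_eqmodMl (s : nat) (c a b : rat) : c \in pintegral p ->
  pint_eqmod p s a b -> pint_eqmod p s (c * a) (c * b).
Proof.
move=> c_p /pint_eqmodP[w w_p ->]; apply/pint_eqmodP.
by exists (c * w); rewrite ?rpredM // mulrDr mulrCA.
Qed.

Lemma pint_eqmodMpX (s t : nat) (a b : rat) :
  pint_eqmod p s a b -> pint_eqmod p (t + s) (p%:R ^+ t * a) (p%:R ^+ t * b).
Proof.
move=> /pint_eqmodP[w w_p ->]; apply/pint_eqmodP.
by exists w; rewrite // exprD mulrDr mulrA.
Qed.

Lemma pint_eqmod_exprD (s n : nat) (x y : rat) :
    x \in pintegral p -> y \in pintegral p ->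
  pint_eqmod p (s + s) ((x + p%:R ^+ s * y) ^+ n)
    (x ^+ n + p%:R ^+ s * (n%:R * x ^+ n.-1 * y)).
Proof.
move=> x_p y_p; elim: n => [|n /pint_eqmodP[w w_p IHn]].
  by apply/pint_eqmodP; exists 0; rewrite ?rpred0 // !expr0; ring.
apply/pint_eqmodP.
exists ((x + p%:R ^+ s * y) * w + n%:R * x ^+ n.-1 * y ^+ 2).
  by rewrite !(rpredD, rpredM, rpredX) ?rpred_nat.
rewrite exprS IHn [n.+1.-1]/=; case: n {IHn} => [|n].
  by rewrite !expr0 exprD; ring.
by rewrite !exprS exprD -natr1; ring.
Qed.

End PIntegralCongruence.

Lemma sum_binomial_powers (R : comPzRingType) (m n : nat) :
  \sum_(j < n.+1) 'C(n.+1, j)%:R * \sum_(i < m) i%:R ^+ j = m%:R ^+ n.+1 :> R.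
Proof.
transitivity (\sum_(0 <= i < m) (i.+1%:R ^+ n.+1 - i%:R ^+ n.+1) : R); last first.
  by rewrite telescope_sumr // expr0n subr0.
under eq_bigr do rewrite mulr_sumr.
rewrite exchange_big big_mkord; apply: eq_bigr => i _ /=.
rewrite -natr1 [i%:R + 1]addrC exprDn [in RHS]big_ord_recr /=.
rewrite subnn expr0 mul1r binn addrK.
by apply: eq_bigr => j _; rewrite expr1n mul1r mulr_natl.
Qed.

Lemma sum_binomial_bernoulli (n : nat) :
  \sum_(j < n.+1) 'C(n.+1, j)%:R * bernoulli j = (n == 0%N)%:R.
Proof.
case: n => [|n]; last exact: bernoulli_rec.
by rewrite big_ord1 bin0 bernoulli0 mulr1.
Qed.

Lemma sum_ord_parity (V : nmodType) (n : nat) (F : nat -> V) :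
  \sum_(i < n.*2.+1) F i = \sum_(i < n.+1) F i.*2 + \sum_(i < n) F i.*2.+1.
Proof.
elim: n => [|n IHn]; first by rewrite !big_ord1 big_ord0 addr0.
rewrite doubleS 2!big_ord_recr /= IHn [\sum_(i < n.+2) _]big_ord_recr.
rewrite [\sum_(i < n.+1) F i.*2.+1]big_ord_recr -!addrA; congr (_ + _).
by rewrite [RHS]addrC -addrA.
Qed.

(* Both sides run over the even numbers below 2n. *)
Lemma sum_ord_double (V : nmodType) (n : nat) (F : nat -> V) : odd n ->
  \sum_(i < n) F i.*2 = \sum_(i < n) F (i + odd i * n)%N.
Proof.
move=> n_odd; have [h ->] : {h | n = h.*2.+1} by exists n./2; lia.
rewrite [RHS](sum_ord_parity _ (fun i => F (i + odd i * h.*2.+1)%N)).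
rewrite -[in LHS]addnn -addSn big_split_ord /=; congr (_ + _).
  by apply: eq_bigr => i _; rewrite odd_double addn0.
by apply: eq_bigr => i _; rewrite /= odd_double; congr F; lia.
Qed.

Lemma sum_sign_parity (R : comPzRingType) (n : nat) (F : nat -> R) :
  \sum_(i < n) (-1) ^+ i * F i = \sum_(i < n) F i - 2 * \sum_(i < n | odd i) F i.
Proof.
rewrite mulr_sumr [X in _ - X]big_mkcond -sumrB; apply: eq_bigr => i _.
by rewrite -signr_odd; case: odd; rewrite ?expr0 ?expr1; ring.
Qed.

Lemma sum_powers_double_eqmod (p n : nat) : odd p ->
  pint_eqmod p 2 (2 ^+ n * \sum_(i < p) i%:R ^+ n)
    (\sum_(i < p) i%:R ^+ n + p%:R * (n%:R * \sum_(i < p | odd i) i%:R ^+ n.-1)).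
Proof.
move=> p_odd; have p_gt0 := odd_gt0 p_odd.
have -> : 2 ^+ n * \sum_(i < p) i%:R ^+ n
    = \sum_(i < p) (i%:R + p%:R ^+ 1 * (odd i)%:R) ^+ n :> rat.
  have := sum_ord_double (fun i => i%:R ^+ n : rat) p_odd.
  under eq_bigr do rewrite -mul2n natrM exprMn.
  rewrite -mulr_sumr => ->.
  by apply: eq_bigr => i _; rewrite natrD natrM mulrC.
rewrite !mulr_sumr [X in _ + X]big_mkcond -big_split.
apply: pint_eqmod_sum => // i _.
rewrite (_ : (if _ then _ else _)
             = p%:R ^+ 1 * (n%:R * i%:R ^+ n.-1 * (odd i)%:R)).
  by apply: (@pint_eqmod_exprD p p_gt0 1); apply: rpred_nat.
by case: odd; rewrite ?mulr1 ?mulr0.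
Qed.

Section PrimeModulus.
Variable p : nat.
Hypothesis p_prime : prime p.
Let p_gt0 : (0 < p)%N := prime_gt0 p_prime.
Let p_neq0 : p%:R != 0 :> rat.
Proof. by rewrite pnatr_eq0 -lt0n. Qed.

Lemma coprime_prime_ltn (c : nat) : (0 < c < p)%N -> coprime c p.
Proof.
by move=> /andP[c_gt0 c_lt]; rewrite coprime_sym prime_coprime // gtnNdvd.
Qed.

Lemma coprime_prime_gt0 (c : nat) : coprime c p -> (0 < c)%N.
Proof.
rewrite lt0n; apply: contraTneq => ->.
by rewrite /coprime gcd0n gtn_eqF ?prime_gt1.
Qed.

Lemma posCoprimeE (n : nat) : posCoprime p n = coprime n p.
Proof. by rewrite /posCoprime; apply: andb_idl; apply: coprime_prime_gt0. Qed.

Lemma pint_eqmod_fermat (c : nat) : coprime c p ->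
  pint_eqmod p 1 (c%:R ^+ p.-1) 1.
Proof.
move=> c_p; have c_gt0 := coprime_prime_gt0 c_p.
have /dvdnP[k fermat] : (p %| c ^ p.-1 - 1)%N.
  rewrite -(@Gauss_dvdr _ c) 1?coprime_sym // mulnBr muln1 -expnS prednK //.
  have /eqP := fermat_little c p_prime; rewrite eqn_mod_dvd //.
  by rewrite -{1}(expn1 c) leq_pexp2l.
apply/(pint_eqmodP p_gt0); exists k%:R; first exact: rpred_nat.
rewrite expr1 -natrM mulnC -fermat -natrX natrB ?expn_gt0 ?c_gt0 //.
by rewrite addrC subrK.
Qed.

Lemma pint_eqmod_exprV (c n : nat) : coprime c p -> (n < p)%N ->
  pint_eqmod p 1 (c%:R ^- n) (c%:R ^+ (p.-1 - n)).
Proof.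
move=> c_p n_lt.
have c_neq0 : c%:R != 0 :> rat by rewrite pnatr_eq0 -lt0n coprime_prime_gt0.
have n_le : (n <= p.-1)%N by rewrite -ltnS prednK.
have /(pint_eqmodP p_gt0)[w w_p fermat] := pint_eqmod_fermat c_p.
apply/(pint_eqmodP p_gt0); exists (- (c%:R ^- n * w)).
  by rewrite rpredN rpredM // -exprVn rpredX ?pintegralV.
have -> : c%:R ^+ (p.-1 - n) = c%:R ^- n * c%:R ^+ p.-1 :> rat.
  by rewrite -[in RHS](subnKC n_le) exprD mulKf ?expf_neq0.
by rewrite fermat; ring.
Qed.

(* The coefficient n + 1 of [f n] in the n-th sum is prime to p. *)
Lemma pintegral_binomial_sums (f : nat -> rat) :
    (forall n, (n.+1 < p)%N ->
       \sum_(j < n.+1) 'C(n.+1, j)%:R * f j \in pintegral p) ->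
  forall n, (n.+1 < p)%N -> f n \in pintegral p.
Proof.
move=> sums_p; elim/ltn_ind => n IHn n_lt.
have := sums_p n n_lt; rewrite big_ord_recr /= binSn.
rewrite rpredDl => [nfn_p|]; last first.
  apply: rpred_sum => j _; apply: rpredM; first exact: rpred_nat.
  by apply: IHn => //; apply: leq_ltn_trans (ltnW n_lt).
rewrite -(mulKf (_ : n.+1%:R != 0) (f n)) ?pnatr_eq0 //.
by rewrite rpredM // pintegralV // coprime_prime_ltn.
Qed.

Lemma bernoulli_pintegral (n : nat) : (n.+1 < p)%N -> bernoulli n \in pintegral p.
Proof.
apply: pintegral_binomial_sums => m _.
by rewrite sum_binomial_bernoulli rpred_nat.
Qed.

(* The power sums and p times the Bernoulli numbers satisfy the same binomial
   recurrence up to the term p^(n+1). *)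
Lemma sum_powers_bernoulli (n : nat) : (n.+1 < p)%N ->
  pint_eqmod p 2 (\sum_(i < p) i%:R ^+ n) (p%:R * bernoulli n).
Proof.
pose f m : rat := (\sum_(i < p) i%:R ^+ m - p%:R * bernoulli m) / (p ^ 2)%:R.
apply: (pintegral_binomial_sums (f := f)) => m _.
have -> : \sum_(j < m.+1) 'C(m.+1, j)%:R * f j
    = (p%:R ^+ m.+1 - p%:R * (m == 0%N)%:R) / (p ^ 2)%:R.
  rewrite -sum_binomial_powers -sum_binomial_bernoulli mulr_sumr -sumrB mulr_suml.
  by apply: eq_bigr => j _; rewrite /f; ring.
case: m => [|m]; first by rewrite mulr1 expr1 subrr mul0r rpred0.
by rewrite mulr0 subr0 natrX -addn2 exprD mulfK ?expf_neq0 // rpredX ?rpred_nat.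
Qed.

Lemma sum_powers_eqmod0 (n : nat) : (n.+1 < p)%N ->
  pint_eqmod p 1 (\sum_(i < p) i%:R ^+ n) 0.
Proof.
move=> n_lt; have /(pint_eqmodP p_gt0)[w w_p ->] := sum_powers_bernoulli n_lt.
apply/(pint_eqmodP p_gt0); exists (bernoulli n + p%:R * w); last by ring.
by rewrite rpredD ?rpredM ?rpred_nat // bernoulli_pintegral.
Qed.

Hypothesis p_odd : odd p.

Lemma bernoulli_sum_odd_powers (n : nat) : (n.+1 < p)%N ->
  pint_eqmod p 1 ((2 ^+ n - 1) * bernoulli n)
    (n%:R * \sum_(i < p | odd i) i%:R ^+ n.-1).
Proof.
move=> n_lt.
have /(pint_eqmodP p_gt0)[v v_p powersE] := sum_powers_bernoulli n_lt.
have /(pint_eqmodP p_gt0)[w w_p] := sum_powers_double_eqmod n p_odd.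
rewrite powersE => doubleE.
apply/(pint_eqmodP p_gt0); exists (w - (2 ^+ n - 1) * v).
  by rewrite rpredB ?rpredM ?rpredB ?rpredX ?rpred_nat ?rpred1.
by apply: (mulfI p_neq0); lra.
Qed.

Lemma sum_odd_powers_bernoulli : (3 < p)%N ->
  pint_eqmod p 1 (\sum_(i < p | odd i) i%:R ^+ (p - 4)) (bernoulli (p - 3) / 4).
Proof.
move=> p_gt3; have n_lt : ((p - 3).+1 < p)%N by lia.
have two_p : coprime 2 p by rewrite coprime2n.
have three_p : coprime 3 p by rewrite coprime_prime_ltn.
set O := \sum_(i < p | _) _; set B := bernoulli _.
have [u u_p fermat2] : exists2 u, u \in pintegral p &
    4 * 2 ^+ (p - 3) = 1 + p%:R * u.
  have /(pint_eqmodP p_gt0)[u u_p] := pint_eqmod_fermat two_p.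
  have -> : p.-1 = (2 + (p - 3))%N by lia.
  by rewrite exprD expr1 => fermat2; exists u; rewrite // -fermat2; ring.
have [v v_p oddE] : exists2 v, v \in pintegral p &
    (2 ^+ (p - 3) - 1) * B = (p%:R - 3) * O + p%:R * v.
  have /(pint_eqmodP p_gt0)[v v_p] := bernoulli_sum_odd_powers n_lt.
  rewrite expr1 (natrB _ (ltnW p_gt3)) (_ : (p - 3).-1 = (p - 4)%N); last by lia.
  by exists v.
apply/(pint_eqmodP p_gt0); exists (12^-1 * (4 * O + 4 * v - u * B)).
  have O_p : O \in pintegral p.
    by rewrite rpred_sum // => i _; rewrite rpredX ?rpred_nat.
  rewrite rpredM ?rpredB ?rpredD ?rpredM ?rpred_nat ?bernoulli_pintegral //.
  rewrite (pintegralV (n := 12)) // (coprimeMl p 3 4) three_p.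
  by rewrite (coprimeMl p 2 2) two_p.
(* Four times oddE, with 4 * 2^(p-3) = 1, reads -3 B = -12 O modulo p. *)
have fermat2B : 4 * 2 ^+ (p - 3) * B = (1 + p%:R * u) * B by rewrite fermat2.
by lra.
Qed.

Lemma sum_sign_powers_bernoulli : (3 < p)%N ->
  pint_eqmod p 1 (\sum_(i < p) (-1) ^+ i * i%:R ^+ (p - 4))
    (- (bernoulli (p - 3) / 2)).
Proof.
move=> p_gt3; have n_lt : ((p - 4).+1 < p)%N by lia.
rewrite (sum_sign_parity _ (fun i => i%:R ^+ (p - 4))).
have /(pint_eqmodP p_gt0)[u u_p ->] := sum_powers_eqmod0 n_lt.
have /(pint_eqmodP p_gt0)[v v_p ->] := sum_odd_powers_bernoulli p_gt3.
apply/(pint_eqmodP p_gt0); exists (u - 2 * v); last by field.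
by rewrite rpredB ?rpredM ?rpred_nat.
Qed.

Lemma sum_sign_inv_cubes_bernoulli :
  pint_eqmod p 1 (\sum_(1 <= i < p) (-1) ^+ i / i%:R ^+ 3)
    (- (bernoulli (p - 3) / 2)).
Proof.
(* For p = 3 the congruence between B_(p-3) and odd powers is void. *)
have [->|p_neq3] := eqVneq p 3%N; first by rewrite unlock /pint_eqmod.
have p_gt4 : (4 < p)%N by have := prime_gt1 p_prime; lia.
pose F (i : nat) : rat := (-1) ^+ i * i%:R ^+ (p - 4).
apply: (@pint_eqmod_trans _ p_gt0 _ (\sum_(1 <= i < p) F i)).
  rewrite !big_nat; apply: pint_eqmod_sum => // i i_lt.
  apply: pint_eqmodMl; rewrite ?rpredX ?rpredN ?rpred1 //.
  have -> : (p - 4 = p.-1 - 3)%N by lia.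
  by apply: pint_eqmod_exprV; [exact: coprime_prime_ltn | lia].
have -> : \sum_(1 <= i < p) F i = \sum_(i < p) F i.
  rewrite -(big_mkord xpredT F) [RHS]big_ltn // /F expr0n subn_eq0 leqNgt p_gt4.
  by rewrite mulr0 add0r.
exact: sum_sign_powers_bernoulli (ltnW p_gt4).
Qed.

End PrimeModulus.

Section IntegersModN.
Variable n : nat.
Hypothesis n_gt1 : (1 < n)%N.

Lemma Zp_gt0 (x : 'Z_n) : (0 < x)%N = (x != 0).
Proof. by rewrite lt0n -val_eqE. Qed.

Lemma ltn_Zp (x : 'Z_n) : (x < n)%N.
Proof. by rewrite -[X in (_ < X)%N](Zp_cast n_gt1) ltn_ord. Qed.

Lemma intr_Zp_eq0 (z : int) : ((z%:~R : 'Z_n) == 0) = (n %| z)%Z.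
Proof.
suff nat_eq0 m : ((m%:R : 'Z_n) == 0) = (n %| m)%N.
  rewrite dvdzE; case: z => m; first exact: nat_eq0.
  by rewrite NegzE rmorphN oppr_eq0 abszN; apply: nat_eq0.
by rewrite -val_eqE /= val_Zp_nat.
Qed.

Lemma val_Zp_opp (x : 'Z_n) : x != 0 -> (- x : 'Z_n) = (n - x)%N :> nat.
Proof.
rewrite -Zp_gt0 /=; move: (nat_of_ord x) => m m_gt0.
by rewrite Zp_cast // modn_small // ltn_subrL m_gt0 ltnW.
Qed.

Lemma signr_Zp_opp (R : pzRingType) (x : 'Z_n) : odd n -> x != 0 ->
  (-1) ^+ (- x : 'Z_n) = - (-1) ^+ x :> R.
Proof.
move=> n_odd x_neq0; rewrite val_Zp_opp // -signr_odd.
rewrite oddB; last exact: ltnW (ltn_Zp x).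
by rewrite n_odd addTb signrN signr_odd.
Qed.

Lemma ltn_Zp_oppD (i j : 'Z_n) : i != 0 -> j != 0 -> i + j != 0 ->
  ((- i : 'Z_n) + (- j : 'Z_n) < n)%N = ~~ (i + j < n)%N.
Proof.
move=> i_neq0 j_neq0 ij_neq0; rewrite !val_Zp_opp //.
have ij_neqn : (i + j)%N != n.
  apply: contra_neq ij_neq0 => ij_n.
  by rewrite -(natr_Zp i) -(natr_Zp j) -natrD ij_n pchar_Zp.
suff opp_ltn m a b : (a < m)%N -> (b < m)%N -> (a + b)%N != m ->
    (m - a + (m - b) < m)%N = ~~ (a + b < m)%N by apply: opp_ltn; rewrite ?ltn_Zp.
by lia.
Qed.

Lemma addn_Zp_eq_modulus (i j k : 'Z_n) : i != 0 -> k != 0 ->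
  (i + j + k == n)%N = (i + j < n)%N && (k == - (i + j)).
Proof.
rewrite -!Zp_gt0 => i_gt0 k_gt0.
have -> : (k == - (i + j)) = (n %| i + j + k)%N.
  have -> : (n %| i + j + k)%N = (n %| Posz (i + j + k))%Z by [].
  by rewrite -intr_Zp_eq0 -pmulrn !natrD !natr_Zp -addr_eq0 addrC.
suff eq_dvdn m a b c : (0 < a)%N -> (0 < c < m)%N ->
    (a + b + c == m)%N = (a + b < m)%N && (m %| a + b + c)%N.
  by apply: eq_dvdn; rewrite ?k_gt0 ?ltn_Zp.
move=> a_gt0 /andP[c_gt0 c_lt]; apply/eqP/andP => [<-|[ab_lt]].
  by rewrite dvdnn -addn1 leq_add2l.
by case/dvdnP=> -[|[|h]]; lia.
Qed.

Lemma sum_nat_Zp (V : nmodType) (F : nat -> V) :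
  \sum_(0 <= i < n) F i = \sum_(x : 'Z_n) F x.
Proof. by rewrite -[in LHS](Zp_cast n_gt1) big_mkord. Qed.

Lemma sum_ord_Zp (V : nmodType) (P : pred nat) (F : nat -> V) : ~~ P n ->
  \sum_(i < n.+1 | P i) F i = \sum_(x : 'Z_n | P x) F x.
Proof.
move=> /negPf Pn; rewrite big_mkcond [RHS]big_mkcond big_ord_recr /= Pn addr0.
by rewrite -(sum_nat_Zp (fun i => if P i then F i else 0)) big_mkord.
Qed.

End IntegersModN.

Definition coprime_triple_sum (V : nmodType) (p n : nat)
    (F : nat -> nat -> nat -> V) : V :=
  \sum_(i < n.+1) \sum_(j < n.+1)
    \sum_(k < n.+1 | [&& (i + j + k == n)%N, posCoprime p i,
                         posCoprime p j & posCoprime p k]) F i j k.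

Section PrimePowerModulus.
Variables (p r : nat).
Hypotheses (p_prime : prime p) (r_gt0 : (0 < r)%N).
Let q : nat := (p ^ r)%N.

Lemma prime_power_gt1 : (1 < q)%N.
Proof. by rewrite -(exp1n r) ltn_exp2r ?prime_gt1. Qed.

Lemma unit_Zpr_nat (n : nat) : ((n%:R : 'Z_q) \is a GRing.unit) = coprime n p.
Proof. by rewrite unitZpE ?prime_power_gt1 // coprime_pexpl // coprime_sym. Qed.

Lemma unit_Zpr (x : 'Z_q) : (x \is a GRing.unit) = coprime x p.
Proof. by rewrite -{1}(natr_Zp x) unit_Zpr_nat. Qed.

Lemma unit_ZprD_or (x y : 'Z_q) :
  x + y \is a GRing.unit -> (x \is a GRing.unit) || (y \is a GRing.unit).
Proof.
rewrite -{1}(natr_Zp x) -{1}(natr_Zp y) -natrD unit_Zpr_nat !unit_Zpr.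
rewrite ![coprime _ p]coprime_sym !prime_coprime // -negb_and.
by apply: contra => /andP[x_p y_p]; rewrite dvdn_add.
Qed.

Lemma num_nonunits_Zpr : num_nonunits 'Z_q = (p ^ r.-1)%N.
Proof.
have card_Zq : #|'Z_q| = (p.-1 * p ^ r.-1 + p ^ r.-1)%N.
  rewrite card_ord Zp_cast ?prime_power_gt1 //.
  by rewrite addnC -mulSn !prednK ?prime_gt0 // -expnS prednK.
have card_units : #|[pred x : 'Z_q | x \is a GRing.unit]| = (p.-1 * p ^ r.-1)%N.
  rewrite -totient_pfactor // -card_units_Zp ?(ltnW prime_power_gt1) //.
  by rewrite cardsT card_sub.
have := cardC [pred x : 'Z_q | x \is a GRing.unit].
by rewrite card_Zq card_units => /addnI.
Qed.

Lemma denq_unit_Zpr (x : rat) :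
  x \in pintegral p -> ((denq x)%:~R : 'Z_q) \is a GRing.unit.
Proof. by move=> x_p; rewrite -absz_denq -pmulrn unit_Zpr_nat. Qed.

Lemma pint_eqmod_ratr (x y : rat) : x \in pintegral p -> y \in pintegral p ->
  ratr x = ratr y :> 'Z_q -> pint_eqmod p r x y.
Proof.
move=> x_p y_p xy; have xy_p : x - y \in pintegral p by rewrite rpredB.
have : ratr (x - y) = 0 :> 'Z_q.
  by rewrite (ratrD denq_unit_Zpr) ?rpredN // ratrN xy subrr.
rewrite /ratr => /(canRL (divrK (denq_unit_Zpr xy_p)))/eqP.
rewrite mul0r intr_Zp_eq0 ?prime_power_gt1 // => /dvdzP[k numE].
apply/pintegralP; exists `|denq (x - y)|%N => //; exists k.
rewrite -/q [`|_|%:R]pmulrn absz_denq mulrAC -numqE numE intrM mulfK //.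
by rewrite pnatr_eq0 -lt0n ltnW // prime_power_gt1.
Qed.

Lemma ratr_sign_frac (n d : nat) : coprime d p ->
  ratr ((-1) ^+ n / d%:R) = (-1) ^+ n / d%:R :> 'Z_q.
Proof.
move=> d_p; have := @ratr_frac 'Z_q ((-1) ^+ n) d.
by rewrite !rmorph_sign -!pmulrn unit_Zpr_nat; apply.
Qed.

Lemma ratr_coprime_triple_sum (F : nat -> nat -> nat -> rat)
    (G : nat -> nat -> nat -> 'Z_q) :
    (forall i j k, coprime i p -> coprime j p -> coprime k p ->
       F i j k \in pintegral p /\ ratr (F i j k) = G i j k) ->
  coprime_triple_sum p q F \in pintegral p /\
  ratr (coprime_triple_sum p q F) = coprime_triple_sum p q G.
Proof.
move=> F_ratr; pose triple (i j k : nat) :=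
  [&& (i + j + k == q)%N, posCoprime p i, posCoprime p j & posCoprime p k].
have F_ratr_triple i j k : triple i j k ->
    F i j k \in pintegral p /\ ratr (F i j k) = G i j k.
  by case/and4P=> _; rewrite !(posCoprimeE p_prime); apply: F_ratr.
have inner_p (i j : nat) : \sum_(k < q.+1 | triple i j k) F i j k \in pintegral p.
  by apply: rpred_sum => k /F_ratr_triple[].
have middle_p (i : nat) :
    \sum_(j < q.+1) \sum_(k < q.+1 | triple i j k) F i j k \in pintegral p.
  by apply: rpred_sum => j _; apply: inner_p.
split; first by apply: rpred_sum => i _; apply: middle_p.
rewrite (ratr_sum denq_unit_Zpr) => [|i _]; last exact: middle_p.
apply: eq_bigr => i _.
rewrite (ratr_sum denq_unit_Zpr) => [|j _]; last exact: inner_p.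
apply: eq_bigr => j _.
rewrite (ratr_sum denq_unit_Zpr) => [|k /F_ratr_triple[]//].
by apply: eq_bigr => k /F_ratr_triple[].
Qed.

Lemma coprime_triple_sum_unit_pairs (V : nmodType) (F : nat -> nat -> nat -> V) :
  coprime_triple_sum p q F
  = \sum_(i : 'Z_q | i \is a GRing.unit)
      \sum_(j | [&& j \is a GRing.unit, i + j \is a GRing.unit & (i + j < q)%N])
        F i j (- (i + j) : 'Z_q).
Proof.
have q_gt1 := prime_power_gt1.
have q_ncoprime : ~~ coprime q p.
  by rewrite coprime_sym prime_coprime // negbK dvdn_exp.
pose inner (i j : nat) :=
  \sum_(k < q.+1 | coprime k p && (i + j + k == q)%N) F i j k.
pose middle (i : nat) := \sum_(j < q.+1 | coprime j p) inner i j.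
transitivity (\sum_(i < q.+1 | coprime i p) middle i).
  rewrite [RHS]big_mkcond; apply: eq_bigr => i _; case: ifP => i_p; last first.
    apply: big1 => j _; apply: big_pred0 => k.
    by rewrite (posCoprimeE p_prime) i_p andbF.
  rewrite [RHS]big_mkcond; apply: eq_bigr => j _; case: ifP => j_p; last first.
    by apply: big_pred0 => k; rewrite !(posCoprimeE p_prime) j_p !andbF.
  by apply: eq_bigl => k; rewrite !(posCoprimeE p_prime) i_p j_p andbC.
rewrite (sum_ord_Zp q_gt1 (P := coprime^~ p) middle) //.
apply: eq_big => [i|i i_p]; first by rewrite unit_Zpr.
rewrite [LHS](sum_ord_Zp q_gt1 (P := coprime^~ p) (inner i)) // [RHS]big_mkcondr.
apply: eq_big => [j|j j_p]; first by rewrite unit_Zpr.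
pose P k := coprime k p && (i + j + k == q)%N.
rewrite [LHS](sum_ord_Zp q_gt1 (P := P) (F i j)) /P ?(negPf q_ncoprime) //.
rewrite (eq_bigl (fun k =>
  ((k \is a GRing.unit) && (i + j < q)%N) && (k == - (i + j)))).
  by rewrite big_mkcondl big_pred1_eq unitrN.
move=> k; rewrite -unit_Zpr -andbA; apply: andb_id2l => k_unit.
by apply: addn_Zp_eq_modulus => //; apply: unitr_neq0; rewrite // unit_Zpr.
Qed.

Lemma natr_Zpr_period (t c : nat) :
  ((t * p + c)%:R : 'Z_q) *+ p ^ r.-1 = c%:R *+ p ^ r.-1.
Proof.
rewrite natrD mulrnDl -mulrnA -mulnA -expnS prednK // mulnC.
by rewrite mulrnA pchar_Zp ?prime_power_gt1 // mul0rn add0r.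
Qed.

Hypothesis p_odd : odd p.

Lemma sum_sign_exprV_Zpr (n : nat) :
  (\sum_(i : 'Z_q | i \is a GRing.unit) (-1) ^+ i / i ^+ n) *+ p ^ r.-1
  = (\sum_(1 <= c < p) (-1) ^+ c / c%:R ^+ n) *+ p ^ r.-1 :> 'Z_q.
Proof.
pose f (m : nat) : 'Z_q := if coprime m p then (-1) ^+ m / m%:R ^+ n else 0.
have f_period t c : f (t * p + c)%N *+ p ^ r.-1 = ((-1) ^+ t * f c) *+ p ^ r.-1.
  have coprime_period : coprime (t * p + c) p = coprime c p.
    by rewrite ![coprime _ p]coprime_sym /coprime gcdnMDl.
  rewrite /f coprime_period; case: ifP => [c_p|]; last by rewrite mulr0.
  rewrite -signr_odd oddD oddM p_odd andbT signr_addb !signr_odd.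
  rewrite -!mulrA -!mulrnAr; congr (_ * (_ * _)).
  apply: mulrn_exprV (natr_Zpr_period t c).
    by rewrite unit_Zpr_nat coprime_period.
  by rewrite unit_Zpr_nat.
have -> : \sum_(i : 'Z_q | i \is a GRing.unit) (-1) ^+ i / i ^+ n
    = \sum_(0 <= m < p ^ r.-1 * p) f m.
  rewrite -expnSr prednK // (sum_nat_Zp prime_power_gt1) big_mkcond.
  by apply: eq_bigr => i _; rewrite /f unit_Zpr natr_Zp.
have -> : \sum_(1 <= c < p) (-1) ^+ c / c%:R ^+ n = \sum_(0 <= c < p) f c.
  rewrite [RHS]big_ltn ?prime_gt0 // [f 0%N](_ : _ = 0) ?add0r; last first.
    by rewrite /f /coprime gcd0n gtn_eqF ?prime_gt1.
  by rewrite !big_nat; apply: eq_bigr => c c_lt; rewrite /f coprime_prime_ltn.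
rewrite big_nat_mul_offset -[in RHS](mul1r (\sum_(0 <= c < p) f c)).
have <- : \sum_(0 <= t < p ^ r.-1) (-1) ^+ t = 1 :> 'Z_q.
  by rewrite big_mkord sum_signr oddX p_odd orbT.
rewrite mulr_suml -!sumrMnl; apply: eq_bigr => t _.
by rewrite mulr_sumr -!sumrMnl; apply: eq_bigr => c _.
Qed.

Lemma sum_sign_inv_triples_Zpr :
  coprime_triple_sum p q (fun i j k => (-1) ^+ i / (i * j * k)%:R)
  = - ((\sum_(1 <= c < p) (-1) ^+ c / c%:R ^+ 3) *+ p ^ r.-1) :> 'Z_q.
Proof.
have two_unit : (2 : 'Z_q) \is a GRing.unit by rewrite unit_Zpr_nat coprime2n.
pose s (i : 'Z_q) : 'Z_q := (-1) ^+ i; pose lt_q (i j : 'Z_q) := (i + j < q)%N.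
have s_opp i : i \is a GRing.unit -> s (- i) = - s i.
  move=> i_unit; rewrite /s signr_Zp_opp ?prime_power_gt1 ?unitr_neq0 //.
  by rewrite oddX p_odd orbT.
have lt_q_opp i j : i \is a GRing.unit -> j \is a GRing.unit ->
    i + j \is a GRing.unit -> lt_q (- i) (- j) = ~~ lt_q i j.
  by move=> *; rewrite /lt_q ltn_Zp_oppD ?prime_power_gt1 ?unitr_neq0.
rewrite coprime_triple_sum_unit_pairs -sum_sign_exprV_Zpr -num_nonunits_Zpr.
rewrite -(sum_half_unit_pairs unit_ZprD_or two_unit s_opp lt_q_opp) -sumrN.
apply: eq_bigr => i _; rewrite -sumrN; apply: eq_bigr => j _.
by rewrite !natrM !natr_Zp mulrN invrN mulrN.
Qed.

Lemma sum_sign_inv_triples_eqmod :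
  pint_eqmod p r
    (coprime_triple_sum p q (fun i j k => (-1) ^+ i / (i * j * k)%:R))
    (- (p%:R ^+ r.-1 * \sum_(1 <= c < p) (-1) ^+ c / c%:R ^+ 3)).
Proof.
rewrite -natrX mulr_natl.
have cube_p c : (0 < c < p)%N -> coprime (c ^ 3) p.
  by move=> c_lt; rewrite coprimeXl // coprime_prime_ltn.
have term_p c : (0 < c < p)%N -> (-1) ^+ c / c%:R ^+ 3 \in pintegral p.
  by move=> c_lt; rewrite -natrX sign_frac_pintegral ?cube_p.
have sum_p : \sum_(1 <= c < p) (-1) ^+ c / c%:R ^+ 3 \in pintegral p.
  by rewrite big_nat rpred_sum.
have [i j k i_p j_p k_p|triple_p ratr_triple] := ratr_coprime_triple_sum
    (F := fun i j k => (-1) ^+ i / (i * j * k)%:R)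
    (G := fun i j k => (-1) ^+ i / (i * j * k)%:R).
  by rewrite sign_frac_pintegral ?ratr_sign_frac // !coprimeMl i_p j_p.
apply: pint_eqmod_ratr; rewrite ?rpredN ?rpredMn //.
rewrite ratr_triple ratrN (ratrMn denq_unit_Zpr) // big_nat.
rewrite (ratr_sum denq_unit_Zpr) //.
rewrite sum_sign_inv_triples_Zpr big_nat; congr (- (_ *+ _)).
by apply: eq_bigr => c c_lt; rewrite -!natrX ratr_sign_frac ?cube_p.
Qed.

End PrimePowerModulus.

Theorem theorem2 (p r : nat) (p_prime : prime p) (p_odd : odd p)
    (r_gt0 : (0 < r)%N) :
  pint_eqmod p r
    (\sum_(i < (p ^ r).+1) \sum_(j < (p ^ r).+1)
       \sum_(k < (p ^ r).+1 | [&& (i + j + k == p ^ r)%N, posCoprime p i,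
                                  posCoprime p j & posCoprime p k])
         (-1) ^+ i / (i * j * k)%N%:R)
    (1 / 2%:R * (p ^ r.-1)%N%:R * bernoulli (p - 3)).
Proof.
have p_gt0 := prime_gt0 p_prime.
apply: (pint_eqmod_trans p_gt0 (sum_sign_inv_triples_eqmod p_prime r_gt0 p_odd)).
have := sum_sign_inv_cubes_bernoulli p_prime p_odd.
move=> /(pint_eqmodMl p_gt0 (rpredN1 _))/(pint_eqmodMpX p_gt0 r.-1).
rewrite addn1 prednK // natrX.
by congr pint_eqmod; field.
Qed.
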